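(* Let $d \ge 1$ be an integer and let $T, S, D > 0$ be real numbers such that the maximum $B_3^+(T,S,D)$ is achieved by some $\lambda^* \in \mathcal{F}_3(T,S;D)$. Then $$B_3^+(T, S, D) = \max\bigl\{ \Lambda : (\Lambda, a, b, j) \in \mathbb{R}_{>0}^3 \times \{0, \ldots, d-1\} \text{ satisfies } (\star_j) \bigr\},$$ where $(\star_j)$ is the system $$\begin{cases} \Lambda + j a + (d - 1 - j) b = T,\\ \Lambda^2 + j a^2 + (d - 1 - j) b^2 = S,\\ \Lambda \cdot a^j \cdot b^{d - 1 - j} = D. \end{cases}$$
   Context: $\mathcal{F}_3(T,S;D) := \{\lambda \in \mathbb{R}^d_{>0} : \sum_{i=1}^d \lambda_i = T,\ \sum_{i=1}^d \lambda_i^2 = S,\ \prod_{i=1}^d \lambda_i = D\}$ and $B_3^+(T,S,D) := \max\{\lambda_1 : \lambda \in \mathcal{F}_3(T,S;D)\}$. *)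

(* Defs.v *)
From mathcomp Require Import all_boot all_order all_algebra.
From mathcomp Require Import all_classical all_reals.

Set Implicit Arguments.
Unset Strict Implicit.
Unset Printing Implicit Defensive.

Import Order.TTheory GRing.Theory Num.Theory.
Local Open Scope classical_set_scope.
Local Open Scope ring_scope.

Definition is_max (R : realType) (A : set R) (m : R) : Prop :=
  A m /\ ubound A m.

(* The value is 0 when A has no greatest element. *)
Definition maxset (R : realType) (A : set R) : R :=
  xget 0 [set m | is_max A m].

Definition F3 (R : realType) (d : nat) (T S D : R) : set 'rV[R]_d :=
  [set lam | [/\ forall i, 0 < lam 0 i,
                 \sum_(i < d) lam 0 i = T,
                 \sum_(i < d) lam 0 i ^+ 2 = S
               & \prod_(i < d) lam 0 i = D]].
Arguments F3 {R} d T S D _.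

(* The coordinates are numbered from 0, so this is lambda_1. *)
Definition coord1 (R : realType) (d : nat) (hd : (1 <= d)%N)
    (lam : 'rV[R]_d) : R :=
  lam 0 (Ordinal hd).

Definition B3plus (R : realType) (d : nat) (hd : (1 <= d)%N) (T S D : R) : R :=
  maxset [set coord1 hd lam | lam in F3 d T S D].

Definition star (R : realType) (d : nat) (T S D : R)
    (L a b : R) (j : nat) : Prop :=
  [/\ L + j%:R * a + (d - 1 - j)%:R * b = T,
      L ^+ 2 + j%:R * a ^+ 2 + (d - 1 - j)%:R * b ^+ 2 = S
    & L * a ^+ j * b ^+ (d - 1 - j) = D].

(* Main.v *)
Require Import Defs.
From mathcomp Require Import all_boot all_order all_algebra.
From mathcomp Require Import all_classical all_reals.
From mathcomp Require Import ring lra.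

Import Order.TTheory GRing.Theory Num.Theory.
Local Open Scope classical_set_scope.
Local Open Scope ring_scope.

(** Let [lam] be a maximizer with first coordinate [L], and suppose that three
    of the other coordinates, [x < y < z], were distinct.  Replace [L] by
    [L + e] and keep the coordinates other than [L, x, y, z] fixed: the three
    constraints then prescribe the elementary symmetric functions of the
    perturbed triple, i.e. a cubic whose coefficients are close to those of
    [(t - x)(t - y)(t - z)].  Having three simple positive roots is stable
    under small perturbations (sign changes and the intermediate value
    theorem), so the perturbed point is feasible, contradicting maximality.
    Hence the other coordinates take at most two values.  No Lagrange
    multiplier, and so no constraint qualification, is involved. *)

(** * Greatest elements of sets of reals *)

Lemma maxset_eq (R : realType) (A : set R) (m : R) :
  is_max A m -> Defs.maxset A = m.
Proof.
move=> [Am ubm]; rewrite /Defs.maxset.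
have [Ax ubx] : is_max A (xget 0 [set m | is_max A m]).
  by apply: (@xgetPex _ 0 [set m | is_max A m]); exists m.
(* Two greatest elements bound each other, so the default 0 never arises. *)
by apply/eqP; rewrite eq_le (ubm _ Ax) (ubx _ Am).
Qed.

(** * Cubics with three positive roots *)

Definition cubic (R : nzRingType) (e1 e2 e3 : R) : {poly R} :=
  'X^3 - e1 *: 'X^2 + e2 *: 'X - e3%:P.

Lemma horner_cubic (R : comNzRingType) (e1 e2 e3 t : R) :
  (cubic R e1 e2 e3).[t] = t ^+ 3 - e1 * t ^+ 2 + e2 * t - e3.
Proof. by rewrite /cubic !hornerE. Qed.

(** Divided differences: subtracting the equations at two roots and cancelling their difference
    gives a quadratic relation; subtracting two such relations isolates [e1], and back-substitution
    gives [e2] and [e3]. *)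
Lemma cubic_vieta (F : fieldType) (e1 e2 e3 x y z : F) :
  x != y -> x != z -> y != z ->
  root (cubic F e1 e2 e3) x -> root (cubic F e1 e2 e3) y ->
  root (cubic F e1 e2 e3) z ->
  [/\ x + y + z = e1, x * y + x * z + y * z = e2 & x * y * z = e3].
Proof.
move=> xy xz yz /rootP + /rootP + /rootP; rewrite !horner_cubic => hx hy hz.
have hxy : x ^+ 2 + x * y + y ^+ 2 - e1 * (x + y) + e2 = 0.
  apply: (@mulfI _ (x - y)); first by rewrite subr_eq0.
  rewrite mulr0 -[RHS](subrr 0) -{1}hx -hy; ring.
have hxz : x ^+ 2 + x * z + z ^+ 2 - e1 * (x + z) + e2 = 0.
  apply: (@mulfI _ (x - z)); first by rewrite subr_eq0.
  rewrite mulr0 -[RHS](subrr 0) -{1}hx -hz; ring.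
have h1 : e1 = x + y + z.
  apply: (@mulfI _ (y - z)); first by rewrite subr_eq0.
  apply/eqP; rewrite eq_sym -subr_eq0; apply/eqP.
  rewrite -[RHS](subrr 0) -{1}hxy -hxz; ring.
have h2 : e2 = x * y + x * z + y * z.
  apply/eqP; rewrite -subr_eq0 -hxy h1; apply/eqP; ring.
have h3 : e3 = x * y * z.
  apply/eqP; rewrite eq_sym -subr_eq0 -hx h1 h2; apply/eqP; ring.
by rewrite h1 h2 h3.
Qed.

(** The value at 0 is [- e3], so the signs at 0, [p1], [p2], [p3] alternate. Each gap holds a root,
    and the gaps being disjoint makes the roots distinct. *)
Lemma cubic_three_roots (R : rcfType) (e1 e2 e3 p1 p2 p3 : R) :
  0 < e3 -> 0 < p1 -> p1 < p2 -> p2 < p3 ->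
  0 < (cubic R e1 e2 e3).[p1] -> (cubic R e1 e2 e3).[p2] < 0 ->
  0 < (cubic R e1 e2 e3).[p3] ->
  exists x y z : R, [/\ 0 < x, 0 < y, 0 < z &
    [/\ x + y + z = e1, x * y + x * z + y * z = e2 & x * y * z = e3]].
Proof.
set P := cubic R e1 e2 e3 => e3_gt0 p1_gt0 p12 p23 P1 P2 P3.
have P0 : P.[0] < 0.
  rewrite horner_cubic; have -> : 0 ^+ 3 - e1 * 0 ^+ 2 + e2 * 0 - e3 = - e3 by ring.
  by rewrite oppr_lt0.
have ivt (Q : {poly R}) (a b : R) :
    a < b -> Q.[a] < 0 -> 0 < Q.[b] -> exists2 t, a < t < b & root Q t.
  move=> ab Qa Qb.
  have [|t /andP[at_ tb] rt] := @poly_ivt _ Q a b (ltW ab).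
    by rewrite !ltW.
  exists t => //; rewrite !lt_neqAle at_ tb !andbT.
  apply/andP; split; apply/eqP => E; move: rt; rewrite /root.
    by rewrite -E (lt_eqF Qa).
  by rewrite E (gt_eqF Qb).
have [x /andP[x0 x1] rx] := ivt P _ _ p1_gt0 P0 P1.
have [||y /andP[y1 y2]] := ivt (- P) p1 p2 p12; rewrite ?hornerN ?oppr_lt0 ?oppr_gt0 //.
rewrite rootN => ry.
have [z /andP[z2 z3] rz] := ivt P _ _ p23 P2 P3.
exists x, y, z; split; [lra|lra|lra|].
by apply: cubic_vieta => //; rewrite lt_eqF //; lra.
Qed.

(** * Perturbing a triple of distinct coordinates *)

Lemma exists_pos_lt (R : realFieldType) (s : seq R) :
  all (fun c => 0 < c) s -> exists2 e : R, 0 < e & all (fun c => e < c) s.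
Proof.
elim: s => [|c s IH] /=; first by exists 1.
move=> /andP[c0 /IH[e e0 /allP es]]; exists (Num.min e (c / 2)).
  by rewrite lt_min e0 /=; lra.
apply/andP; split; first by rewrite gt_min; apply/orP; right; lra.
by apply/allP => u /es eu; rewrite gt_min eu.
Qed.

Lemma perturb_triple (R : rcfType) (L x y z : R) :
  0 < L -> 0 < x -> x < y -> y < z ->
  exists e x' y' z' : R,
    [/\ [/\ 0 < e, 0 < x', 0 < y' & 0 < z'],
        (L + e) + (x' + (y' + z')) = L + (x + (y + z)),
        (L + e) ^+ 2 + (x' ^+ 2 + (y' ^+ 2 + z' ^+ 2)) =
          L ^+ 2 + (x ^+ 2 + (y ^+ 2 + z ^+ 2))
      & (L + e) * (x' * (y' * z')) = L * (x * (y * z))].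
Proof.
move=> L0 x0 xy yz.
pose s := x + y + z; pose p := x * y * z.
pose P0 t := (t - x) * (t - y) * (t - z).
(* Sample points between the roots of [P0] and beyond the last one, where [P0] has signs +, -, +. *)
pose p1 := (x + y) / 2; pose p2 := (y + z) / 2; pose p3 := z + 1.
have s0 : 0 < s by rewrite /s; lra.
have p0 : 0 < p by rewrite /p !mulr_gt0 //; lra.
have P1 : 0 < P0 p1.
  by rewrite /P0 nmulr_lgt0; [rewrite pmulr_rlt0|]; rewrite /p1; lra.
have P2 : P0 p2 < 0.
  by rewrite /P0 pmulr_rlt0; [|rewrite mulr_gt0 //]; rewrite /p2; lra.
have P3 : 0 < P0 p3.
  by rewrite /P0 !mulr_gt0 //; rewrite /p3; lra.
have p1_gt0 : 0 < p1 by rewrite /p1; lra.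
have p2_gt0 : 0 < p2 by rewrite /p2; lra.
have p3_gt0 : 0 < p3 by rewrite /p3; lra.
(* [e * M] bounds the upward part of the perturbation at [p2] once [e < 1]; at [p1] and [p3] the
   downward part is only [e * s * t]. *)
pose M := p2 ^+ 2 + (L + 1) * p2 + p / L.
have M0 : 0 < M.
  rewrite /M !addr_gt0 ?mulr_gt0 ?invr_gt0 ?exprn_gt0 //; lra.
have sp1 : 0 < s * p1 by exact: mulr_gt0.
have sp3 : 0 < s * p3 by exact: mulr_gt0.
have [|e e0 /= /and5P[e1 eP1 eP3 eP2 _]] :=
    @exists_pos_lt R [:: 1; P0 p1 / (s * p1); P0 p3 / (s * p3); - P0 p2 / M].
  by rewrite /= ltr01 !divr_gt0 ?oppr_gt0.
move: eP1 eP3 eP2; rewrite !ltr_pdivlMr // => eP1 eP3 eP2.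
have Le0 : 0 < L + e by lra.
(* The constraints force these symmetric functions, together with the sum [s - e]; [r] is the
   resulting change [p - f3] of the constant term. *)
pose f2 := x * y + x * z + y * z + e * (L - s) + e ^+ 2.
pose f3 := p * L / (L + e).
pose r := p * e / (L + e).
have r0 : 0 < r by apply: divr_gt0 => //; exact: mulr_gt0.
have rM : r <= e * (p / L).
  rewrite /r (mulrC p e) (mulrA e p) ler_wpM2l //; first exact/ltW/mulr_gt0.
  by rewrite lef_pV2 ?posrE //; lra.
have PE t : (cubic R (s - e) f2 f3).[t] =
    P0 t + e * t ^+ 2 + (e * (L - s) + e ^+ 2) * t + r.
  rewrite horner_cubic /P0 /f2 /f3 /r /s /p; field; exact: lt0r_neq0.
have above t : 0 < t -> e * (s * t) < P0 t ->
    0 < P0 t + e * t ^+ 2 + (e * (L - s) + e ^+ 2) * t + r.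
  move=> t0 et; have : 0 < e * t ^+ 2 by rewrite mulr_gt0 ?exprn_gt0.
  have : 0 < e * L * t by rewrite !mulr_gt0.
  have : 0 < e ^+ 2 * t by rewrite mulr_gt0 ?exprn_gt0.
  move: r0 et; lra.
(* Here the term [- e * s * t] helps, [e ^+ 2 * t] is at most [e * t], and [rM] bounds [r]. *)
have below t : 0 < t -> e * (t ^+ 2 + (L + 1) * t + p / L) < - P0 t ->
    P0 t + e * t ^+ 2 + (e * (L - s) + e ^+ 2) * t + r < 0.
  move=> t0 et; have : e ^+ 2 * t <= e * t by rewrite ler_pM2r // expr2; nra.
  have : 0 < e * s * t by rewrite mulr_gt0 // mulr_gt0.
  move: rM et; lra.
have [|||||||x' [y' [z' [x'0 y'0 z'0 [V1 V2 V3]]]]] :=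
    @cubic_three_roots R (s - e) f2 f3 p1 p2 p3; rewrite ?PE //.
- by apply: divr_gt0 => //; exact: mulr_gt0.
- by rewrite /p1 /p2; lra.
- by rewrite /p2 /p3; lra.
- exact: above.
- exact: below.
- exact: above.
exists e, x', y', z'; split => //.
- by move: V1; rewrite /s; lra.
- have -> : x' ^+ 2 + (y' ^+ 2 + z' ^+ 2) =
      (x' + y' + z') ^+ 2 - 2 * (x' * y' + x' * z' + y' * z') by ring.
  rewrite V1 V2 /f2 /s; ring.
- by rewrite (mulrA x') V3 /f3 /p; field; exact: lt0r_neq0.
Qed.

(** * Big operators and two-valued vectors *)

Lemma eq_big_off (T : Type) (idx : T) (op : Monoid.com_law idx) (I : finType)
    (s : seq I) (F G : I -> T) :
  uniq s -> (forall i, i \notin s -> F i = G i) ->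
  \big[op/idx]_(i <- s) F i = \big[op/idx]_(i <- s) G i ->
  \big[op/idx]_i F i = \big[op/idx]_i G i.
Proof.
move=> us eqFG eqs.
rewrite (bigID [in s]) [RHS](bigID [in s]) /= -!big_uniq // eqs.
by congr (op _ _); apply: eq_bigr.
Qed.

Lemma card_predC_ord (n : nat) (u : pred 'I_n) : #|[predC u]| = (n - #|u|)%N.
Proof.
rewrite -[LHS](addKn #|u|); congr (_ - _)%N.
by rewrite cardC card_ord.
Qed.

Lemma sum_if (R : pzRingType) (n : nat) (u : pred 'I_n) (a b : R) :
  \sum_(i < n) (if u i then a else b) = #|u|%:R * a + (n - #|u|)%:R * b.
Proof.
rewrite (bigID u) /=; congr (_ + _).
  under eq_bigr => i ui do rewrite ui.
  by rewrite sumr_const mulr_natl.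
under eq_bigr => i /negbTE ui do rewrite ui.
rewrite sumr_const mulr_natl; congr (_ *+ _).
exact: card_predC_ord.
Qed.

Lemma prod_if (R : comPzRingType) (n : nat) (u : pred 'I_n) (a b : R) :
  \prod_(i < n) (if u i then a else b) = a ^+ #|u| * b ^+ (n - #|u|).
Proof.
rewrite (bigID u) /=; congr (_ * _).
  under eq_bigr => i ui do rewrite ui.
  by rewrite prodr_const.
under eq_bigr => i /negbTE ui do rewrite ui.
rewrite prodr_const; congr (_ ^+ _).
exact: card_predC_ord.
Qed.

(** Only the number of places holding [a] matters, not their positions. Hence one equivalence serves
    both an initial segment of indices and a level set of a maximizer. *)
Lemma star_two_values (R : realType) (n : nat) (T S D L a b : R)
    (u : pred 'I_n) (lam : 'rV[R]_n.+1) :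
  lam 0 ord0 = L -> (forall i, lam 0 (lift ord0 i) = if u i then a else b) ->
  star n.+1 T S D L a b #|u| <->
  [/\ \sum_(i < n.+1) lam 0 i = T, \sum_(i < n.+1) lam 0 i ^+ 2 = S
    & \prod_(i < n.+1) lam 0 i = D].
Proof.
move=> l0 lS; rewrite /star !big_ord_recl l0 subn1 /=.
under eq_bigr do rewrite lS.
under [\sum_(i < n) _ ^+ 2]eq_bigr do rewrite lS (fun_if (fun t => t ^+ 2)).
under [\prod_(i < n) _]eq_bigr do rewrite lS.
by rewrite !sum_if prod_if !addrA (mulrA L).
Qed.

Lemma card_ltn_ord (n j : nat) : (j <= n)%N -> #|[pred i : 'I_n | (i < j)%N]| = j.
Proof.
by move=> jn; rewrite -sum1_card -(big_ord_widen n (fun=> 1%N)) // sum1_card card_ord.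
Qed.

Lemma star_feasible (R : realType) (n : nat) (T S D L a b : R) (j : nat) :
  (j <= n)%N -> 0 < L -> 0 < a -> 0 < b -> star n.+1 T S D L a b j ->
  exists2 lam, F3 n.+1 T S D lam & lam 0 ord0 = L.
Proof.
move=> jn L0 a0 b0; rewrite -{1}(card_ltn_ord n j jn) => st.
pose lam : 'rV[R]_n.+1 := \row_i
  (if unlift ord0 i is Some k then (if (k < j)%N then a else b) else L).
have l0 : lam 0 ord0 = L by rewrite mxE unlift_none.
have lS i : lam 0 (lift ord0 i) = if (i < j)%N then a else b by rewrite mxE liftK.
exists lam => //.
have [h1 h2 h3] := (star_two_values R n T S D L a b _ lam l0 lS).1 st.
split=> // i; case: (unliftP ord0 i) => [k|] ->; rewrite ?l0 // lS.
by case: ifP.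
Qed.

(** * Structure of a maximizer *)

Lemma max_no_sorted_triple (R : realType) (n : nat) (T S D : R)
    (lam : 'rV[R]_n.+1) :
  F3 n.+1 T S D lam ->
  (forall mu, F3 n.+1 T S D mu -> mu 0 ord0 <= lam 0 ord0) ->
  forall i j k : 'I_n.+1, i != ord0 -> j != ord0 -> k != ord0 ->
  lam 0 i < lam 0 j -> lam 0 j < lam 0 k -> False.
Proof.
move=> [lam0 lT lS lD] lmax i j k i0 j0 k0 ij jk.
have [e [x [y [z [[e0 x0 y0 z0] h1 h2 h3]]]]] :=
  perturb_triple R _ _ _ _ (lam0 ord0) (lam0 i) ij jk.
have nij : i != j by apply: contraTneq ij => ->; rewrite ltxx.
have njk : j != k by apply: contraTneq jk => ->; rewrite ltxx.
have nik : i != k by apply: contraTneq (lt_trans ij jk) => ->; rewrite ltxx.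
(* Only these four coordinates change, so each constraint reduces to an identity of
   [perturb_triple]. *)
pose s := [:: ord0; i; j; k].
have us : uniq s.
  by rewrite /= !inE !negb_or ![ord0 == _]eq_sym i0 j0 k0 nij nik njk.
pose mu : 'rV[R]_n.+1 := \row_l
  (if l == ord0 then lam 0 ord0 + e else if l == i then x
   else if l == j then y else if l == k then z else lam 0 l).
have mu0 : mu 0 ord0 = lam 0 ord0 + e by rewrite mxE eqxx.
have mui : mu 0 i = x by rewrite mxE (negbTE i0) eqxx.
have muj : mu 0 j = y by rewrite mxE (negbTE j0) (eq_sym j i) (negbTE nij) eqxx.
have muk : mu 0 k = z.
  by rewrite mxE (negbTE k0) (eq_sym k i) (negbTE nik) (eq_sym k j) (negbTE njk) eqxx.
have off l : l \notin s -> mu 0 l = lam 0 l.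
  by rewrite !inE !negb_or mxE => /and4P[/negbTE-> /negbTE-> /negbTE-> /negbTE->].
have muF : F3 n.+1 T S D mu.
  split.
  - by move=> l; rewrite mxE; do 4?[case: ifP => _] => //; rewrite addr_gt0.
  - rewrite -lT; apply: (eq_big_off _ _ _ _ s) => //.
    by rewrite !big_cons !big_nil /= !addr0 mu0 mui muj muk.
  - rewrite -lS; apply: (eq_big_off _ _ _ _ s) => // [l /off-> //|].
    by rewrite !big_cons !big_nil /= !addr0 mu0 mui muj muk.
  - rewrite -lD; apply: (eq_big_off _ _ _ _ s) => //.
    by rewrite !big_cons !big_nil /= !mulr1 mu0 mui muj muk.
by have := lmax _ muF; rewrite mu0; lra.
Qed.

Lemma max_two_values (R : realType) (n : nat) (T S D : R)
    (lam : 'rV[R]_n.+1) :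
  F3 n.+1 T S D lam ->
  (forall mu, F3 n.+1 T S D mu -> mu 0 ord0 <= lam 0 ord0) ->
  exists a b : R, [/\ 0 < a, 0 < b &
    forall i, i != ord0 -> lam 0 i = a \/ lam 0 i = b].
Proof.
move=> lamF lmax; have no3 := max_no_sorted_triple R n T S D lam lamF lmax.
have [lam0 _ _ _] := lamF.
have [[i [j [i0 j0 /eqP nij]]]|same] := pselect (exists i j : 'I_n.+1,
    [/\ i != ord0, j != ord0 & lam 0 i <> lam 0 j]); last first.
  have [[i i0]|none] := pselect (exists i : 'I_n.+1, i != ord0).
    exists (lam 0 i), (lam 0 i); split=> // k k0; left.
    by apply: contrapT => nk; apply: same; exists k, i.
  (* There is no other coordinate, so any positive values will do. *)
  exists 1, 1; split=> // i i0; exfalso; apply: none; by exists i.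
(* A third value would give a sorted triple in one of six orders. *)
exists (lam 0 i), (lam 0 j); split=> // k k0.
have [ki|ki|] := ltgtP (lam 0 k) (lam 0 i); last by left.
- have [kj|kj|] := ltgtP (lam 0 k) (lam 0 j); last by right.
  + have [ij|ij|/eqP] := ltgtP (lam 0 i) (lam 0 j); last by rewrite (negbTE nij).
      by case: (no3 k i j).
    by case: (no3 k j i).
  + by case: (no3 j k i).
- have [kj|kj|] := ltgtP (lam 0 k) (lam 0 j); last by right.
  + by case: (no3 i k j).
  + have [ij|ij|/eqP] := ltgtP (lam 0 i) (lam 0 j); last by rewrite (negbTE nij).
      by case: (no3 i j k).
    by case: (no3 j i k).
Qed.

Theorem theorem4p2 (R : realType) (d : nat) (hd : (1 <= d)%N) (T S D : R)
  (hT : 0 < T) (hS : 0 < S) (hD : 0 < D)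
  (hmax : exists2 lamstar : 'rV[R]_d, F3 d T S D lamstar &
     is_max [set coord1 hd lam | lam in F3 d T S D] (coord1 hd lamstar)) :
  is_max
    [set L : R | exists (a b : R) (j : 'I_d),
       [/\ 0 < L, 0 < a, 0 < b & star d T S D L a b j]]
    (B3plus hd T S D).
Proof.
case: hmax => lam lamF lamM; rewrite /B3plus (maxset_eq _ _ _ lamM).
case: lamM => _ lam_ub; case: d hd lam lamF lam_ub => // n hd lam lamF lam_ub.
have c1 mu : coord1 hd mu = mu 0 ord0 by congr (mu 0 _); apply: val_inj.
have lmax mu : F3 n.+1 T S D mu -> mu 0 ord0 <= lam 0 ord0.
  by move=> muF; rewrite -!c1; apply: lam_ub; exists mu.
rewrite c1; split => /=.
  have [a [b [a0 b0 ab]]] := max_two_values R n T S D lam lamF lmax.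
  have [lam0 lT lS lD] := lamF.
  (* The places outside [u] all hold [b], so [j] is the cardinality of [u]; it is at most [n], hence
     less than [d]. *)
  pose u := [pred i : 'I_n | lam 0 (lift ord0 i) == a].
  have un : (#|u| < n.+1)%N by rewrite ltnS -[n in leqRHS]card_ord max_card.
  exists a, b, (Ordinal un); split=> //=.
  apply/(star_two_values R n T S D _ a b u lam) => // i /=.
  by case: eqP => // /eqP na; case: (ab (lift ord0 i)) => // E; rewrite E eqxx in na.
move=> L [a [b [j [L0 a0 b0 st]]]].
have [mu muF <-] := star_feasible R n T S D L a b j (ltn_ord j) L0 a0 b0 st.
exact: lmax.
Qed.
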